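(* Let $(M,\nabla,h)$ be a K-V manifold and let $N\subset M$ be a K-V transversal, so that $T_NM=TN\oplus h_\#(TN^\circ)$. Let $p:T_NM\to TN$ be the projection associated with this decomposition, and let $h^N$ be the unique symmetric bivector field on $N$ such that $h^N_\#:T^*N\to TN$ is the composition $$T^*N\xrightarrow{\,p^*\,}T^*_NM\xrightarrow{\,h_\#\,}T_NM\xrightarrow{\,p\,}TN .$$ Then $(N,\nabla,h^N)$ is a K-V manifold, where $N$ carries the affine connection induced by $\nabla$.
   Context: An affine manifold $(M,\nabla)$ is a manifold with a flat torsion-free connection $\nabla$ on $TM$. For a symmetric bivector field $h$ on $M$, let $h_\#:T^*M\to TM$, $\alpha\mapsto\alpha^\#$, be defined by $\beta(\alpha^\#)=h(\alpha,\beta)$. The triple $(M,\nabla,h)$ is a Koszul-Vinberg (K-V) manifold if $(\nabla_{\alpha^\#}h)(\beta,\gamma)=(\nabla_{\beta^\#}h)(\alpha,\gamma)$ for all $\alpha,\beta,\gamma\in\Omega^1(M)$. An affine submanifold $N$ of $(M,\nabla)$ is a submanifold with a flat torsion-free connection (the one induced by $\nabla$, still denoted $\nabla$) such that the inclusion maps geodesics to geodesics; equivalently, parallel transport of $M$ along curves in $N$ preserves $TN$. $T_NM$ denotes the restriction of $TM$ to $N$, $T^*_NM$ that of $T^*M$, and $TN^\circ\subset T^*_NM$ is the annihilator of $TN$. A K-V transversal of $(M,\nabla,h)$ is an affine submanifold $N\subset M$ such that $T_xM=T_xN+h_\#(T_xN^\circ)$ for every $x\in N$; by dimension count the sum is then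 direct. *)

(* Defs.v *)
From HB Require Import structures.
From mathcomp Require Import all_boot all_order all_algebra.
From mathcomp Require Import all_classical all_reals all_analysis.
Set Implicit Arguments.
Unset Strict Implicit.
Unset Printing Implicit Defensive.
Import Order.TTheory GRing.Theory Num.Theory.
Import numFieldNormedType.Exports.
Local Open Scope classical_set_scope.
Local Open Scope ring_scope.

(* C^oo on D, meant for D open: every iterated directional derivative of f is
   (Frechet) differentiable at every point of D. *)
Definition smooth_on (R : realType) (V W : normedModType R) (D : set V)
    (f : V -> W) : Prop :=
  forall (s : seq V) (x : V), D x ->
    differentiable (foldr (fun v g => 'D_v g) f s) x.

(* Smooth n-manifolds.  The atlas is indexed by the points: coord a is a chart
   whose domain dom a contains a, and param a is its inverse.  Every smooth
   atlas contains a subatlas of this form, with the same smooth structure. *)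
Record manifold (R : realType) (n : nat) := Manifold {
  point :> topologicalType;
  dom : point -> set point;
  coord : point -> point -> 'rV[R]_n;
  param : point -> 'rV[R]_n -> point;
  point_hausdorff : hausdorff_space point;
  point_second_countable : @second_countable point;
  dom_open : forall a, open (dom a);
  dom_self : forall a, dom a a;
  coord_continuous : forall a x, dom a x -> {for x, continuous (coord a)};
  coord_image_open : forall a, open (coord a @` dom a);
  param_continuous : forall a u, (coord a @` dom a) u ->
    {for u, continuous (param a)};
  coordK : forall a x, dom a x -> param a (coord a x) = x;
  transition_smooth : forall a b,
    smooth_on (coord a @` (dom a `&` dom b)) (coord b \o param a) }.

Section Tensors.
Context (R : realType) (n : nat) (M : manifold R n).
Implicit Types (a x y : M) (v : 'rV[R]_n) (U : set M).

(* T_x M is identified with row vectors and T*_x M with column vectors, through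
   the chart coord x: a field or form is given at x by its components in the
   chart indexed by x, and a bivector by its Gram matrix on the dual basis. *)
Definition vfield := M -> 'rV[R]_n.
Definition oneform := M -> 'cV[R]_n.
Definition bivector := M -> 'M[R]_n.

(* Jacobian at y of the change of coordinates from chart a to chart b; it acts
   on rows by right multiplication. *)
Definition transition a b y : 'M[R]_n :=
  'J (coord b \o param a) (coord a y).

(* components at y with respect to the chart indexed by a *)
Definition vfield_in (X : vfield) a y := X y *m transition y a y.
Definition oneform_in (al : oneform) a y := transition a y y *m al y.
Definition bivector_in (h : bivector) a y :=
  (transition y a y)^T *m h y *m transition y a y.

Definition smooth_in_charts (W : normedModType R) U (F : M -> M -> W) : Prop :=
  forall a, smooth_on (coord a @` (U `&` dom a)) (F a \o param a).

Definition smooth_fun U (f : M -> R) := smooth_in_charts U (fun=> f).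
Definition smooth_vfield U (X : vfield) := smooth_in_charts U (vfield_in X).
Definition smooth_oneform U (al : oneform) :=
  smooth_in_charts U (oneform_in al).
Definition smooth_bivector U (h : bivector) :=
  smooth_in_charts U (bivector_in h).

Definition symmetric_bivector_field (h : bivector) : Prop :=
  (forall x, (h x)^T = h x) /\ smooth_bivector setT h.

(* al |-> al^#, characterized by be (al^#) = h (al, be) *)
Definition sharp k (H : 'M[R]_k) (al : 'cV[R]_k) : 'rV[R]_k := al^T *m H.

Definition biv_eval k (H : 'M[R]_k) (al be : 'cV[R]_k) : R :=
  (al^T *m H *m be) 0 0.

Definition dfun x v (f : M -> R) : R := 'D_v (f \o param x) (coord x x).

(* j-th coordinate vector field of the chart indexed by a *)
Definition frame a (j : 'I_n) : vfield := fun y => row j (transition a y y).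

Definition lie_bracket (X Y : vfield) : vfield := fun x =>
  'D_(X x) (vfield_in Y x \o param x) (coord x x)
  - 'D_(Y x) (vfield_in X x \o param x) (coord x x).

End Tensors.
Arguments vfield {R n} M.
Arguments oneform {R n} M.
Arguments bivector {R n} M.

Section Connections.
Context (R : realType) (n : nat) (M : manifold R n).

(* nabla x v Y is the derivative of the field Y at x in the direction v.  It is
   only meaningful when Y is smooth on an open neighbourhood of x. *)
Definition covderiv := M -> 'rV[R]_n -> vfield M -> 'rV[R]_n.
Implicit Types (nabla : covderiv) (U : set M).

Definition is_connection nabla : Prop :=
  [/\ forall U x (k : R) (v w : 'rV[R]_n) (Y : vfield M),
        open U -> U x -> smooth_vfield U Y ->
        nabla x (k *: v + w) Y = k *: nabla x v Y + nabla x w Y,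
      forall U x (v : 'rV[R]_n) (Y Z : vfield M),
        open U -> U x -> smooth_vfield U Y -> smooth_vfield U Z ->
        nabla x v (fun y => Y y + Z y) = nabla x v Y + nabla x v Z,
      forall U x (v : 'rV[R]_n) (f : M -> R) (Y : vfield M),
        open U -> U x -> smooth_fun U f -> smooth_vfield U Y ->
        nabla x v (fun y => f y *: Y y) = dfun x v f *: Y x + f x *: nabla x v Y
    & forall U (X Y : vfield M),
        open U -> smooth_vfield U X -> smooth_vfield U Y ->
        smooth_vfield U (fun x => nabla x (X x) Y)].

Definition torsion_free nabla : Prop :=
  forall U x (X Y : vfield M), open U -> U x ->
    smooth_vfield U X -> smooth_vfield U Y ->
    nabla x (X x) Y - nabla x (Y x) X = lie_bracket X Y x.

Definition flat nabla : Prop :=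
  forall U x (X Y Z : vfield M), open U -> U x ->
    smooth_vfield U X -> smooth_vfield U Y -> smooth_vfield U Z ->
    nabla x (X x) (fun y => nabla y (Y y) Z)
    - nabla x (Y x) (fun y => nabla y (X y) Z)
    = nabla x (lie_bracket X Y x) Z.

Definition affine_manifold nabla : Prop :=
  [/\ is_connection nabla, torsion_free nabla & flat nabla].

(* (nabla_v be)(Y) = v (be Y) - be (nabla_v Y), on the coordinate frame at x *)
Definition nabla_form nabla x (v : 'rV[R]_n) (be : oneform M) : 'cV[R]_n :=
  \col_j (dfun x v (fun y => (frame x j y *m be y) 0 0)
          - (nabla x v (frame x j) *m be x) 0 0).

(* (nabla_v h)(be, ga) at x *)
Definition nabla_biv nabla (h : bivector M) x (v : 'rV[R]_n)
    (be ga : oneform M) : R :=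
  dfun x v (fun y => biv_eval (h y) (be y) (ga y))
  - biv_eval (h x) (nabla_form nabla x v be) (ga x)
  - biv_eval (h x) (be x) (nabla_form nabla x v ga).

Definition KV_manifold nabla (h : bivector M) : Prop :=
  [/\ affine_manifold nabla, symmetric_bivector_field h
    & forall U x (al be ga : oneform M), open U -> U x ->
        smooth_oneform U al -> smooth_oneform U be -> smooth_oneform U ga ->
        nabla_biv nabla h x (sharp (h x) (al x)) be ga
        = nabla_biv nabla h x (sharp (h x) (be x)) al ga].

(* Covariant derivative at e, in the direction w, of a vector field V along
   f : E -> M (V e is a tangent vector at f e), by the Leibniz rule on
   V = \sum_j V_j (frame a j \o f) for the chart a at f e. *)
Definition cov_along nabla (E : normedModType R) (f : E -> M)
    (V : E -> 'rV[R]_n) (e w : E) : 'rV[R]_n :=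
  let a := f e in
  'D_w (fun e' => V e' *m transition (f e') a (f e')) e
  + \sum_j V e 0 j *: nabla a ('D_w (coord a \o f) e) (frame a j).

Definition velocity (c : R -> M) (t : R) : 'rV[R]_n :=
  'D_(1 : R) (coord (c t) \o c) t.

Definition smooth_curve (I : set R) (c : R -> M) : Prop :=
  (forall t, I t -> {for t, continuous c}) /\
  forall b, smooth_on (I `&` c @^-1` dom b) (coord b \o c).

Definition geodesic nabla (I : set R) (c : R -> M) : Prop :=
  smooth_curve I c /\
  forall t, I t -> cov_along nabla c (velocity c) t (1 : R) = 0.

End Connections.
Arguments covderiv {R n} M.

Section Submanifolds.
Context (R : realType) (m n : nat) (M : manifold R m) (N : manifold R n).
Implicit Types (iota : N -> M) (nabla : covderiv M) (nablaN : covderiv N).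

(* tangent map at x, acting on rows; its action on columns is the dual map *)
Definition tangent_map iota (x : N) : 'M[R]_(n, m) :=
  'J (coord (iota x) \o iota \o param x) (coord x x).

Definition smooth_map iota : Prop :=
  continuous iota /\
  forall a b, smooth_on (coord a @` (dom a `&` iota @^-1` dom b))
                        (coord b \o iota \o param a).

(* iota is the inclusion of an immersed submanifold *)
Definition submanifold iota : Prop :=
  [/\ smooth_map iota, injective iota & forall x, row_free (tangent_map iota x)].

(* nablaN is the connection that nabla induces on N: for Y tangent to N and v
   in T_x N, nabla_v Y is tangent to N and equal to nablaN_v Y. *)
Definition induced_connection nabla iota nablaN : Prop :=
  forall U (x : N) (v : 'rV[R]_n) (Y : vfield N),
    open U -> U x -> smooth_vfield U Y ->
    cov_along nabla (iota \o param x)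
      (fun u => Y (param x u) *m tangent_map iota (param x u)) (coord x x) v
    = nablaN x v Y *m tangent_map iota x.

Definition affine_submanifold nabla iota nablaN : Prop :=
  [/\ submanifold iota, affine_manifold nablaN,
      induced_connection nabla iota nablaN
    & forall (s t : R) (c : R -> N),
        geodesic nablaN `]s, t[ c -> geodesic nabla `]s, t[ (iota \o c)].

Definition in_annihilator iota (x : N) (al : 'cV[R]_m) : Prop :=
  tangent_map iota x *m al = 0.

Definition KV_transversal nabla (h : bivector M) iota nablaN : Prop :=
  affine_submanifold nabla iota nablaN /\
  forall (x : N) (w : 'rV[R]_m), exists (v : 'rV[R]_n) (al : 'cV[R]_m),
    in_annihilator iota x al /\
    w = v *m tangent_map iota x + sharp (h (iota x)) al.

(* p x : T_{iota x} M -> T_x N is the projection onto T_x N along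
   h_#(T_x N^o); it acts on rows, and on columns as the dual map p^*. *)
Definition transversal_projection (h : bivector M) iota
    (p : N -> 'M[R]_(m, n)) : Prop :=
  forall x : N,
    tangent_map iota x *m p x = 1%:M /\
    forall al, in_annihilator iota x al -> sharp (h (iota x)) al *m p x = 0.

Definition induced_bivector (h : bivector M) iota (p : N -> 'M[R]_(m, n))
    (hN : bivector N) : Prop :=
  symmetric_bivector_field hN /\
  forall (x : N) (al : 'cV[R]_n),
    sharp (hN x) al = sharp (h (iota x)) (p x *m al) *m p x.

End Submanifolds.

(* Main.v *)
Require Import Defs.
From mathcomp Require Import all_boot all_order all_algebra.
From mathcomp Require Import all_classical all_reals all_analysis.
From mathcomp Require Import ring.
Set Implicit Arguments.
Unset Strict Implicit.
Unset Printing Implicit Defensive.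
Import Order.TTheory GRing.Theory Num.Theory.
Import numFieldNormedType.Exports.
(* Imported again because [mathcomp.algebra.vector] also defines [coord]. *)
Import Defs.
Local Open Scope classical_set_scope.
Local Open Scope ring_scope.

(* Fix x in N, a chart of N at x and a chart of M at iota x.  Let J be the
   matrix of d(iota), P that of p, H and K = P^T H P those of h and h^N, and let
   C_v be the Christoffel matrix of a connection in the direction v.  The
   bilinear form nabla_v h has matrix T(v) = D_v H + C_v^T H + H C_v, and the
   K-V condition says that b^T T(a^#) c is symmetric in the covectors a and b.
   Since p^* a annihilates h_#(TN^o), its sharp is tangent to N, that is
   P^T H = K J.  Differentiating J P = 1 and K = P^T H P, and using
   D_v J + J C_(vJ) = C^N_v J (the connection of N is induced by that of M), one
   gets T^N(v) = P^T T(v J) P.  As (P a)^# = a^# J, the K-V condition for h at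
   P a, P b, P c is the K-V condition for h^N at a, b, c.
   Smoothness of h^N comes from the formula P = (J^T J + Q H)^-1 J^T, where Q is
   the orthogonal projection onto the kernel of J. *)

(** * Smooth functions *)

Section NearCongruence.
Context (R : realType) (V W : normedModType R).

(** The difference [g - f] vanishes near [x], so it is a constant plus the zero map plus a little-o:
    its differential is zero, and [g = f + (g - f)]. *)
Lemma near_eq_differentiable (f g : V -> W) (x : V) :
  (\near x, f x = g x) -> differentiable f x -> differentiable g x.
Proof.
move=> fg df; have -> : g = f + (g - f) by rewrite addrC subrK.
apply: differentiableD => //.
have e0 : (g - f) \o shift x = cst ((g - f) x) + \0 +o_ 0 id.
  apply/eqaddoP => _ /posnumP[e]; near=> h.
  have fgx : f x = g x by exact: nbhs_singleton fg.
  have fgh : f (h + x) = g (h + x).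
    by near: h; move: fg; rewrite (near_shift 0) subr0.
  rewrite /= !fctE /= fgx fgh.
  by rewrite !subrr addr0 subr0 normr0 mulr_ge0.
have d0 : 'd (g - f) x = \0 :> (V -> W).
  by apply: diff_unique => // y; exact: cvg_cst.
by apply/diff_locallyP; rewrite d0; split=> // y; exact: cvg_cst.
Unshelve. all: by end_near. Qed.

Lemma open_near_eq (D : set V) (f g : V -> W) (x : V) : open D -> D x ->
  {in D, f =1 g} -> \near x, f x = g x.
Proof.
move=> oD Dx fg; have : nbhs x D by exact: open_nbhs_nbhs.
by apply: filterS => y Dy; apply: fg; rewrite inE.
Qed.

End NearCongruence.

Section SmoothCalculus.
Context (R : realType) (V : normedModType R).
Implicit Types (W : normedModType R) (D : set V).

(* C^k rather than a list of directions as in smooth_on: the sums of products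
   created by the Leibniz and chain rules stay within the induction. *)
Fixpoint Ck_on W k D (f : V -> W) : Prop :=
  (forall x, D x -> differentiable f x) /\
  if k is k'.+1 then forall v, Ck_on k' D ('D_v f) else True.

Lemma Ck_onW W k D (f : V -> W) : Ck_on k.+1 D f -> Ck_on k D f.
Proof.
by elim: k f => [|k IH] f [df Df]; split => // v; apply: IH; exact: Df.
Qed.

Lemma smooth_onP W D (f : V -> W) : smooth_on D f <-> forall k, Ck_on k D f.
Proof.
split=> [sf k|].
  elim: k f sf => [|k IH] f sf; split=> //; do ?exact: (sf [::]).
  (* In [foldr] the last direction of the list is the first to differentiate [f], hence [rcons] here
     and induction from the right end in the converse. *)
  move=> v; apply: IH => s x Dx; have := sf (rcons s v) x Dx.
  by rewrite -cats1 foldr_cat.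
move=> Cf s; elim/last_ind: s f Cf => [|s v IH] f Cf x Dx.
  by have [] := Cf 0%N; move=> /(_ x Dx).
rewrite -cats1 foldr_cat /=; apply: IH => // k.
by have [_] := Cf k.+1; exact.
Qed.

Lemma smooth_on_differentiable W D (f : V -> W) x :
  smooth_on D f -> D x -> differentiable f x.
Proof. by move=> sf; exact: (sf [::]). Qed.

Lemma smooth_on_derive W D (f : V -> W) v :
  smooth_on D f -> smooth_on D ('D_v f).
Proof.
by move=> sf s x Dx; have := sf (rcons s v) x Dx; rewrite -cats1 foldr_cat.
Qed.

(** [smooth_on] is a condition at each point separately, so the sets [E] need no compatibility. This
    lets the chart of [M] vary with the point in [smooth_induced_bivector]. *)
Lemma smooth_on_local W D (f : V -> W) :
  (forall x, D x -> exists2 E, smooth_on E f & E x) -> smooth_on D f.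
Proof. by move=> loc s x /loc[E sE Ex]; exact: sE. Qed.

(** As [D] is open, equality on [D] is equality near each of its points; it passes to the
    derivatives, and the induction goes on. *)
Lemma Ck_on_ext W k D (f g : V -> W) : open D -> {in D, f =1 g} ->
  Ck_on k D f -> Ck_on k D g.
Proof.
move=> oD; elim: k f g => [|k IH] f g fg [df Df].
  split=> // x Dx; apply: near_eq_differentiable (df _ Dx).
  exact: open_near_eq fg.
split=> [x Dx|v].
  by apply: near_eq_differentiable (df _ Dx); exact: open_near_eq fg.
apply: IH (Df v) => x; rewrite inE => Dx.
by apply: near_eq_derive; exact: open_near_eq fg.
Qed.

Lemma smooth_on_ext W D (f g : V -> W) : open D -> {in D, f =1 g} ->
  smooth_on D f -> smooth_on D g.
Proof.
by move=> oD fg /smooth_onP Cf; apply/smooth_onP => k; exact: Ck_on_ext (Cf k).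
Qed.

Lemma Ck_on_cst W k D (c : W) : Ck_on k D (cst c : V -> W).
Proof.
elim: k c => [|k IH] c; split=> // v.
by rewrite (_ : 'D_v _ = cst 0)//; apply/funext => x; rewrite derive_cst.
Qed.

Lemma smooth_on_cst W D (c : W) : smooth_on D (fun=> c).
Proof. by apply/smooth_onP => k; exact: Ck_on_cst. Qed.

Lemma Ck_onD W k D (f g : V -> W) : open D ->
  Ck_on k D f -> Ck_on k D g -> Ck_on k D (fun x => f x + g x).
Proof.
move=> oD; elim: k f g => [|k IH] f g [df Df] [dg Dg].
  by split=> // x Dx; apply: differentiableD; [exact: df|exact: dg].
split=> [x Dx|v]; first by apply: differentiableD; [exact: df|exact: dg].
apply: Ck_on_ext (IH _ _ (Df v) (Dg v)) => // x; rewrite inE => Dx.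
by rewrite -deriveD//; apply: diff_derivable; [exact: df|exact: dg].
Qed.

Lemma smooth_onD W D (f g : V -> W) : open D ->
  smooth_on D f -> smooth_on D g -> smooth_on D (fun x => f x + g x).
Proof.
move=> oD /smooth_onP Cf /smooth_onP Cg; apply/smooth_onP => k.
exact: Ck_onD.
Qed.

Lemma Ck_onM k D (f g : V -> R) : open D ->
  Ck_on k D f -> Ck_on k D g -> Ck_on k D (fun x => f x * g x).
Proof.
move=> oD; elim: k f g => [|k IH] f g Cf Cg.
  by split=> // x Dx; apply: differentiableM; [apply: Cf.1|apply: Cg.1].
split=> [x Dx|v]; first by apply: differentiableM; [apply: Cf.1|apply: Cg.1].
have := Ck_onD oD (IH _ _ (Ck_onW Cf) (Cg.2 v)) (IH _ _ (Ck_onW Cg) (Cf.2 v)).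
apply: Ck_on_ext => // x; rewrite inE => Dx.
by rewrite -deriveM//; apply: diff_derivable; [apply: Cf.1|apply: Cg.1].
Qed.

Lemma smooth_onM D (f g : V -> R) : open D ->
  smooth_on D f -> smooth_on D g -> smooth_on D (fun x => f x * g x).
Proof.
move=> oD /smooth_onP Cf /smooth_onP Cg; apply/smooth_onP => k.
exact: Ck_onM.
Qed.

Lemma Ck_onV k D (f : V -> R) : open D -> (forall x, D x -> f x != 0) ->
  Ck_on k D f -> Ck_on k D (fun x => (f x)^-1).
Proof.
move=> oD f0; elim: k => [|k IH] Cf.
  by split=> // x Dx; apply: differentiableV; [apply: Cf.1|apply: f0].
split=> [x Dx|v]; first by apply: differentiableV; [apply: Cf.1|apply: f0].
(* The derivative of [1/f] is [-(1/f)(1/f) f'], where [1/f] is C^k by the induction hypothesis. *)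
have CV := IH (Ck_onW Cf).
have := Ck_onM oD (@Ck_on_cst R k D (-1)) (Ck_onM oD (Ck_onM oD CV CV) (Cf.2 v)).
apply: Ck_on_ext => // x; rewrite inE => Dx.
rewrite deriveV ?f0//; last by apply: diff_derivable; apply: Cf.1.
by rewrite /= mulN1r scaleNr expr2 invfM.
Qed.

Lemma smooth_onV D (f : V -> R) : open D -> (forall x, D x -> f x != 0) ->
  smooth_on D f -> smooth_on D (fun x => (f x)^-1).
Proof.
by move=> oD f0 /smooth_onP Cf; apply/smooth_onP => k; exact: Ck_onV.
Qed.

Lemma Ck_on_sum W k D I (r : seq I) (P : pred I) (F : I -> V -> W) : open D ->
  (forall i, P i -> Ck_on k D (F i)) ->
  Ck_on k D (fun x => \sum_(i <- r | P i) F i x).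
Proof.
move=> oD CF; elim: r => [|i r IH].
  by apply: Ck_on_ext (Ck_on_cst k D 0) => // x _; rewrite big_nil.
have [Pi|/negPf nPi] := boolP (P i).
  apply: Ck_on_ext (Ck_onD oD (CF i Pi) IH) => // x _.
  by rewrite big_cons Pi.
by apply: Ck_on_ext IH => // x _; rewrite big_cons nPi.
Qed.

Lemma smooth_on_sum W D I (r : seq I) (P : pred I) (F : I -> V -> W) :
  open D -> (forall i, P i -> smooth_on D (F i)) ->
  smooth_on D (fun x => \sum_(i <- r | P i) F i x).
Proof.
move=> oD sF; apply/smooth_onP => k; apply: Ck_on_sum => // i Pi.
by move/smooth_onP: (sF i Pi).
Qed.

Lemma smooth_on_prod D I (r : seq I) (F : I -> V -> R) :
  open D -> (forall i, smooth_on D (F i)) ->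
  smooth_on D (fun x => \prod_(i <- r) F i x).
Proof.
move=> oD sF; elim: r => [|i r IH].
  by apply: smooth_on_ext (@smooth_on_cst R D 1) => // x _; rewrite big_nil.
by apply: smooth_on_ext (smooth_onM oD (sF i) IH) => // x _; rewrite big_cons.
Qed.

Lemma differentiable_mx p q (F : V -> 'M[R]_(p, q)) x :
  (forall i j, differentiable (fun y => F y i j) x) -> differentiable F x.
Proof.
move=> dF.
have -> : F = \sum_(ij : 'I_p * 'I_q)
    (fun y => F y ij.1 ij.2 *: (delta_mx ij.1 ij.2 : 'M[R]_(p, q))).
  apply/funext => y; rewrite fct_sumE {1}[F y]matrix_sum_delta pair_bigA.
  by [].
elim/big_ind: _ => [|f g df dg|ij _].
- exact: (differentiable_cst (0 : 'M[R]_(p, q))).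
- exact: differentiableD.
- exact: differentiableZl.
Qed.

Lemma differentiable_entry p q (F : V -> 'M[R]_(p, q)) x i j :
  differentiable F x -> differentiable (fun y => F y i j) x.
Proof.
move=> dF; apply: (@differentiable_comp _ _ _ _ F (fun M => M i j)) => //.
exact: differentiable_coord.
Qed.

Lemma derive_entry p q (F : V -> 'M[R]_(p, q)) x v i j :
  derivable F x v -> ('D_v F x) i j = 'D_v (fun y => F y i j) x.
Proof. by move=> dF; rewrite derive_mx// mxE. Qed.

Lemma Ck_on_mx p q k D (F : V -> 'M[R]_(p, q)) : open D ->
  (forall i j, Ck_on k D (fun x => F x i j)) <-> Ck_on k D F.
Proof.
move=> oD; elim: k F => [|k IH] F.
  split=> [CF|CF i j]; split=> // x Dx.
    by apply: differentiable_mx => i j; apply: (CF i j).1.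
  by apply: differentiable_entry; apply: CF.1.
split=> [CF|CF i j].
  have dF x : D x -> differentiable F x.
    by move=> Dx; apply: differentiable_mx => i j; apply: (CF i j).1.
  split=> // v; apply/IH => i j.
  apply: Ck_on_ext ((CF i j).2 v) => // x; rewrite inE => Dx.
  by rewrite derive_entry//; apply: diff_derivable; exact: dF.
split=> [x Dx|v]; first by apply: differentiable_entry; apply: CF.1.
have /IH/(_ i j) := CF.2 v; apply: Ck_on_ext => // x; rewrite inE => Dx.
by rewrite derive_entry//; apply: diff_derivable; apply: CF.1.
Qed.

Lemma smooth_on_mx p q D (F : V -> 'M[R]_(p, q)) : open D ->
  (forall i j, smooth_on D (fun x => F x i j)) <-> smooth_on D F.
Proof.
move=> oD; split=> [sF|/smooth_onP sF i j]; apply/smooth_onP => k.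
  by apply/Ck_on_mx => // i j; move/smooth_onP: (sF i j).
by apply: (Ck_on_mx k F oD).2.
Qed.

Lemma smooth_on_mulmx p q r D (F : V -> 'M[R]_(p, q)) (G : V -> 'M[R]_(q, r)) :
  open D -> smooth_on D F -> smooth_on D G ->
  smooth_on D (fun x => F x *m G x).
Proof.
move=> oD /(smooth_on_mx _ oD) sF /(smooth_on_mx _ oD) sG.
apply/smooth_on_mx => // i j.
apply: (@smooth_on_ext _ _ (fun x => \sum_k F x i k * G x k j)) => //.
  by move=> x _; rewrite mxE.
by apply: smooth_on_sum => // k _; exact: smooth_onM.
Qed.

Lemma smooth_on_trmx p q D (F : V -> 'M[R]_(p, q)) :
  open D -> smooth_on D F -> smooth_on D (fun x => (F x)^T).
Proof.
move=> oD /(smooth_on_mx _ oD) sF; apply/smooth_on_mx => // i j.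
by apply: smooth_on_ext (sF j i) => // x _; rewrite mxE.
Qed.

Lemma smooth_on_det p D (F : V -> 'M[R]_p) :
  open D -> smooth_on D F -> smooth_on D (fun x => \det (F x)).
Proof.
move=> oD /(smooth_on_mx _ oD) sF; apply: smooth_on_sum => // s _.
by apply: smooth_onM => //; [exact: smooth_on_cst|exact: smooth_on_prod].
Qed.

(** Cramer's rule: the entries of the inverse are cofactors divided by the determinant. *)
Lemma smooth_on_invmx p D (F : V -> 'M[R]_p) : open D ->
  (forall x, D x -> F x \in unitmx) ->
  smooth_on D F -> smooth_on D (fun x => invmx (F x)).
Proof.
move=> oD uF sF; apply/smooth_on_mx => // i j.
apply: (@smooth_on_ext _ _ (fun x => (\det (F x))^-1 * cofactor (F x) j i)) => //.
  by move=> x; rewrite inE => Dx; rewrite /invmx uF// !mxE.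
apply: smooth_onM => //.
  apply: smooth_onV => //; last exact: smooth_on_det.
  by move=> x /uF; rewrite unitmxE unitfE.
apply: smooth_onM => //; first exact: smooth_on_cst.
apply: smooth_on_det => //; move/(smooth_on_mx _ oD): sF => sF.
apply/smooth_on_mx => // k l.
by apply: smooth_on_ext (sF (lift j k) (lift i l)) => // x _; rewrite !mxE.
Qed.

End SmoothCalculus.

(** * Chain rule and Jacobians *)

Section Jacobian.
Context (R : realType).

Lemma derive_comp (U V W : normedModType R) (g : U -> V) (f : V -> W) x v :
  differentiable g x -> differentiable f (g x) ->
  'D_v (f \o g) x = 'D_('D_v g x) f (g x).
Proof.
move=> dg df; rewrite deriveE; last exact: differentiable_comp.
by rewrite diff_comp//= -deriveE// -deriveE.
Qed.

Lemma derive_basis n (W : normedModType R) (f : 'rV[R]_n -> W) x v :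
  differentiable f x ->
  'D_v f x = \sum_j v 0 j *: 'D_(delta_mx 0 j) f x.
Proof.
move=> df; rewrite deriveE// {1}(row_sum_delta v) linear_sum.
by apply: eq_bigr => j _; rewrite linearZ deriveE.
Qed.

(** In ['D_('D_v g x) f (g x)] the direction moves with [x]. Expanding it on the standard basis
    leaves the fixed partial derivatives of [f], composed with [g], to which the induction
    hypothesis applies. *)
Lemma Ck_on_comp n (U : normedModType R) k (D : set U) (E : set 'rV[R]_n)
    (g : U -> 'rV[R]_n) (f : 'rV[R]_n -> R) :
  open D -> D `<=` g @^-1` E -> Ck_on k D g -> Ck_on k E f ->
  Ck_on k D (f \o g).
Proof.
move=> oD DE; elim: k f => [|k IH] f Cg Cf.
  by split=> // x Dx; apply: differentiable_comp; [apply: Cg.1|apply/Cf.1/DE].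
split=> [x Dx|v].
  by apply: differentiable_comp; [apply: Cg.1|apply/Cf.1/DE].
pose F := fun x => \sum_j ('D_v g x) 0 j * ('D_(delta_mx 0 j) f \o g) x.
apply: (@Ck_on_ext _ _ _ _ _ F) => //.
  move=> x; rewrite inE => Dx.
  have dg : differentiable g x by apply: Cg.1.
  have df : differentiable f (g x) by apply/Cf.1/DE.
  by rewrite derive_comp// derive_basis.
apply: Ck_on_sum => // j _; apply: Ck_onM => //.
  by move: 0 j; apply/Ck_on_mx => //; exact: Cg.2.
by apply: IH; [exact: Ck_onW|exact: Cf.2].
Qed.

Lemma smooth_on_comp n p q (U : normedModType R) (D : set U)
    (E : set 'rV[R]_n) (g : U -> 'rV[R]_n) (f : 'rV[R]_n -> 'M[R]_(p, q)) :
  open D -> open E -> D `<=` g @^-1` E -> smooth_on D g -> smooth_on E f ->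
  smooth_on D (f \o g).
Proof.
move=> oD oE DE /smooth_onP Cg /(smooth_on_mx _ oE) sf.
apply/smooth_on_mx => // i j; apply/smooth_onP => k.
apply: (@Ck_on_comp _ _ k D E g (fun y => f y i j)) => //.
by have /smooth_onP := sf i j.
Qed.

Context (n m : nat).
Implicit Types f g : 'rV[R]_n -> 'rV[R]_m.

Lemma jacobianE f x : differentiable f x ->
  'J f x = \matrix_(i, j) ('D_(delta_mx 0 i) f x) 0 j.
Proof. by move=> df; apply/matrixP => i j; rewrite !mxE deriveE. Qed.

Lemma smooth_on_jacobian (D : set 'rV[R]_n) f : open D ->
  smooth_on D f -> smooth_on D (fun x => 'J f x).
Proof.
move=> oD sf; apply/smooth_on_mx => // i j.
have := smooth_on_derive (delta_mx 0 i) sf.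
move=> /(smooth_on_mx _ oD)/(_ 0 j); apply: smooth_on_ext => // x.
rewrite inE => Dx.
by rewrite jacobianE ?mxE//; exact: smooth_on_differentiable sf Dx.
Qed.

Lemma near_eq_jacobian f g x :
  (\near x, f x = g x) -> differentiable f x -> 'J f x = 'J g x.
Proof.
move=> fg df; have dg := near_eq_differentiable fg df.
rewrite !jacobianE//; apply/matrixP => i j; rewrite !mxE.
by rewrite (near_eq_derive _ fg).
Qed.

(** Tangent vectors are rows, so the Jacobian of the inner map stands on the left. *)
Lemma jacobian_comp p (g : 'rV[R]_p -> 'rV[R]_n) f x :
  differentiable g x -> differentiable f (g x) ->
  'J (f \o g) x = 'J g x *m 'J f (g x).
Proof.
move=> dg df; apply/row_matrixP => i; rewrite row_mul !rowE.
rewrite -!deriveEjacobian//; first by rewrite derive_comp.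
exact: differentiable_comp.
Qed.

End Jacobian.

Lemma jacobian_id (R : realType) n (x : 'rV[R]_n) : 'J id x = 1%:M.
Proof.
apply/row_matrixP => i; rewrite !rowE -deriveEjacobian// derive_id mulmx1.
by [].
Qed.

(** * Leibniz rule for matrix products *)

Section MatrixDerivative.
Context (R : realType) (V : normedModType R).

Lemma derivable_mulmx p q r (F : V -> 'M[R]_(p, q)) (G : V -> 'M[R]_(q, r))
    x v : derivable F x v -> derivable G x v ->
  derivable (fun y => F y *m G y) x v.
Proof.
move=> /derivable_mxP dF /derivable_mxP dG; apply/derivable_mxP => i j.
have -> : (fun y => (F y *m G y) i j) =
  \sum_k ((fun y => F y i k) * (fun y => G y k j)).
  by apply/funext => y; rewrite mxE fct_sumE.
apply: derivable_sum => k; exact: derivableM.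
Qed.

Lemma derive_mulmx p q r (F : V -> 'M[R]_(p, q)) (G : V -> 'M[R]_(q, r)) x v :
  derivable F x v -> derivable G x v ->
  'D_v (fun y => F y *m G y) x = 'D_v F x *m G x + F x *m 'D_v G x.
Proof.
move=> dF dG; have dFG := derivable_mulmx dF dG.
move/derivable_mxP: (dF) => dF'; move/derivable_mxP: (dG) => dG'.
apply/matrixP => i j; rewrite derive_entry// !mxE -big_split/=.
have -> : (fun y => (F y *m G y) i j) =
  \sum_k ((fun y => F y i k) * (fun y => G y k j)).
  by apply/funext => y; rewrite mxE fct_sumE.
rewrite derive_sum; last by move=> k; exact: derivableM.
apply: eq_bigr => k _; rewrite deriveM// addrC !derive_entry//.
by congr (_ + _); exact: mulrC.
Qed.

Lemma derivable_trmx p q (F : V -> 'M[R]_(p, q)) x v :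
  derivable F x v -> derivable (fun y => (F y)^T) x v.
Proof.
move=> /derivable_mxP dF; apply/derivable_mxP => i j.
by under eq_fun do rewrite mxE; exact: dF.
Qed.

Lemma derive_trmx p q (F : V -> 'M[R]_(p, q)) x v :
  derivable F x v -> 'D_v (fun y => (F y)^T) x = ('D_v F x)^T.
Proof.
move=> dF; apply/matrixP => i j.
rewrite derive_entry; last exact: derivable_trmx.
by rewrite mxE derive_entry//; congr ('D_v _ x); apply/funext => y; rewrite mxE.
Qed.

End MatrixDerivative.

(** * Projections along a transversal *)

Section TransversalAlgebra.
Context (R : realType) (n m : nat).
Implicit Types (J : 'M[R]_(n, m)) (H : 'M[R]_m) (P : 'M[R]_(m, n)).

(** Transversality and, below, the projection at a single point: the rows of [J] span TN, and
    [J *m al = 0] says that [al] annihilates TN. *)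
Definition transversal_mx J H := forall w : 'rV[R]_m,
  exists (v : 'rV[R]_n) (al : 'cV[R]_m), J *m al = 0 /\ w = v *m J + sharp H al.

Definition is_projection J H P :=
  J *m P = 1%:M /\ forall al, J *m al = 0 -> sharp H al *m P = 0.

(** Both projections send [v *m J + sharp H al] to [v], and by transversality every vector has this
    form. *)
Lemma is_projection_unique J H P P' : transversal_mx J H ->
  is_projection J H P -> is_projection J H P' -> P = P'.
Proof.
move=> trJ [JP HP] [JP' HP']; apply/row_matrixP => i; rewrite !rowE.
have [v [al [Jal ->]]] := trJ (delta_mx 0 i).
by rewrite !mulmxDl -!(mulmxA v) JP JP' HP// HP'.
Qed.

(** If [w] kills the Gram matrix, the squares of the entries of [w *m J] sum to zero; over the reals
    this forces [w *m J = 0]. *)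
Lemma gram_unitmx J : row_free J -> J *m J^T \in unitmx.
Proof.
move=> fJ; rewrite -row_free_unit; apply: inj_row_free => w wJ0.
have : (w *m J) *m (w *m J)^T = 0.
  by rewrite trmx_mul !mulmxA -[w *m J *m _]mulmxA wJ0 mul0mx.
move=> /matrixP/(_ 0 0); rewrite mxE [RHS]mxE => /eqP.
rewrite psumr_eq0 => [/allP s0|k _]; last by rewrite [_^T _ _]mxE -expr2 sqr_ge0.
apply/eqP; rewrite -(mulmx_free_eq0 _ fJ); apply/eqP/rowP => k.
have := s0 k (mem_index_enum _).
by rewrite [_^T _ _]mxE -expr2 sqrf_eq0 [in RHS]mxE => /eqP.
Qed.

(* Orthogonal projection of T*M onto the annihilator of the row space of J. *)
Definition annihilator_proj J := 1%:M - J^T *m invmx (J *m J^T) *m J.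

(* On the orthogonal splitting T*M = (row space of J) + annihilator, this is
   J^T J plus the restriction of H to the annihilator, so that it is invertible
   when J is transversal to H. *)
Definition splitting J H := J^T *m J + annihilator_proj J *m H.

Definition projection J H := invmx (splitting J H) *m J^T.

Lemma mul_splitting J H :
  row_free J -> J *m splitting J H = J *m J^T *m J.
Proof.
move=> fJ; rewrite mulmxDr /annihilator_proj !mulmxA mulmxBr mulmx1 !mulmxA.
by rewrite mulmxV ?gram_unitmx// mul1mx subrr mul0mx addr0.
Qed.

Lemma annihilator_splitting J H al :
  J *m al = 0 -> al^T *m splitting J H = sharp H al.
Proof.
move=> Jal; have alJ : al^T *m J^T = 0 by rewrite -trmx_mul Jal trmx0.
rewrite mulmxDr /annihilator_proj !mulmxA mulmxBr mulmx1 !mulmxA alJ.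
by rewrite !mul0mx add0r subr0.
Qed.

(** The row space of the splitting matrix contains the rows of [J], by [mul_splitting], and every
    [sharp H al] with [al] in the annihilator, by [annihilator_splitting]. Transversality says that
    these span everything. *)
Lemma splitting_unitmx J H :
  row_free J -> transversal_mx J H -> splitting J H \in unitmx.
Proof.
move=> fJ trJ; have uG := gram_unitmx fJ.
rewrite -row_full_unit -sub1mx; apply/row_subP => i; rewrite row1.
have [v [al [Jal ->]]] := trJ (delta_mx 0 i).
apply/submxP; exists (v *m invmx (J *m J^T) *m J + al^T).
rewrite mulmxDl annihilator_splitting// -(mulmxA _ J) mul_splitting//.
by rewrite mulmxA mulmxKV.
Qed.

(** Write [S] for the splitting matrix and [G = J J^T]. From [J S = G J] follows
    [G (J P) = J J^T = G], and [G] cancels. From [al^T S = sharp H al] follows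
    [sharp H al *m P = al^T J^T = 0]. *)
Lemma projectionP J H :
  row_free J -> transversal_mx J H -> is_projection J H (projection J H).
Proof.
move=> fJ trJ; have uG := gram_unitmx fJ.
have uS := splitting_unitmx fJ trJ; split.
  apply: (can_inj (mulKmx uG)); rewrite /projection !mulmxA.
  by rewrite -(mul_splitting H)// mulmxK// mulmx1.
move=> al Jal; rewrite -(annihilator_splitting H Jal) /projection mulmxA mulmxK//.
by rewrite -trmx_mul Jal trmx0.
Qed.

(* H maps p^* T*N into TN, the annihilator of the annihilator of TN. *)
Lemma projection_sharp J H P : H^T = H -> is_projection J H P ->
  P^T *m H = P^T *m H *m P *m J.
Proof.
(* The columns of [Z] annihilate TN, so [HP] gives [Z^T H P = 0]; transposing, with [H] symmetric,
   gives [P^T H Z = 0], which is the claim. *)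
move=> sH [JP HP]; pose Z := 1%:M - P *m J.
have JZ : J *m Z = 0 by rewrite mulmxBr mulmx1 mulmxA JP mul1mx subrr.
have ZHP : Z^T *m H *m P = 0.
  apply/row_matrixP => i; rewrite row0 !row_mul -tr_col; apply: HP.
  by rewrite colE mulmxA JZ mul0mx.
apply/eqP; rewrite -subr_eq0 -{1}[P^T *m H]mulmx1 -(mulmxA _ P) -mulmxBr.
by apply/eqP/trmx_inj; rewrite trmx0 !trmx_mul trmxK sH mulmxA ZHP.
Qed.

(** * Changes of basis, by [A] on the submanifold and by [C] on the ambient space *)

Section ChangeOfBasis.
Variables (A A' : 'M[R]_n) (C C' : 'M[R]_m).
Hypotheses (AA' : A *m A' = 1%:M) (CC' : C *m C' = 1%:M).

Lemma transversal_mx_change J H : transversal_mx J H ->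
  transversal_mx (A *m J *m C) (C^T *m H *m C).
Proof.
move=> trJ w; have [v [al [Jal wE]]] := trJ (w *m C').
have A'A := mulmx1C AA'; have C'C := mulmx1C CC'.
exists (v *m A'), (C' *m al); split.
  by rewrite -!mulmxA (mulmxA C) CC' mul1mx Jal mulmx0.
rewrite /sharp trmx_mul !mulmxA -(mulmxA v) A'A mulmx1.
rewrite -(mulmxA al^T) -trmx_mul CC' trmx1 mulmx1 -mulmxDl.
by rewrite -[in RHS]/(sharp H al) -wE -mulmxA C'C mulmx1.
Qed.

Lemma is_projection_change J H P : is_projection J H P ->
  is_projection (A *m J *m C) (C^T *m H *m C) (C' *m P *m A').
Proof.
move=> [JP HP]; have A'A := mulmx1C AA'; have C'C := mulmx1C CC'; split.
  by rewrite !mulmxA -(mulmxA _ C) CC' mulmx1 -(mulmxA A) JP mulmx1.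
move=> al Jal; have JCal : J *m (C *m al) = 0.
  have : A' *m (A *m J *m C *m al) = 0 by rewrite Jal mulmx0.
  by rewrite !mulmxA A'A mul1mx.
rewrite /sharp !mulmxA -trmx_mul -(mulmxA _ C C') CC' mulmx1.
by rewrite -/(sharp H _) HP// mul0mx.
Qed.

Lemma row_free_change J : row_free J -> row_free (A *m J *m C).
Proof.
move=> /row_freeP[B JB]; apply/row_freeP; exists (C' *m B *m A').
by rewrite !mulmxA -(mulmxA _ C) CC' mulmx1 -(mulmxA A) JB mulmx1.
Qed.

End ChangeOfBasis.

End TransversalAlgebra.

(** * Charts *)

Section Charts.
Context (R : realType).

Section OneManifold.
Context (n : nat) (M : manifold R n).
Implicit Types (a b x y : M) (U : set M).

(** Near [coord a x] the image consists of the points that the continuous [param a] sends into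
    [U]. *)
Lemma open_chart_image a U : open U -> open (coord a @` (U `&` dom a)).
Proof.
move=> oU; have oD := @coord_image_open _ _ M a.
rewrite openE => _ [x [Ux ax] <-].
have xD : (coord a @` dom a) (coord a x) by exists x.
have : nbhs (coord a x) (coord a @` dom a) by exact: open_nbhs_nbhs.
have : nbhs (coord a x) (param a @^-1` U).
  by apply: (param_continuous xD); rewrite coordK//; exact: open_nbhs_nbhs.
rewrite /interior; apply: filterS2 => u Uu [z az zu]; exists z => //.
by split=> //; rewrite -(coordK az) zu.
Qed.

Lemma chart_imageP a U u : (coord a @` (U `&` dom a)) u ->
  [/\ U (param a u), dom a (param a u) & coord a (param a u) = u].
Proof. by move=> [x [Ux ax] <-]; rewrite coordK. Qed.

Lemma chart_image_coord a U y :
  U y -> dom a y -> (coord a @` (U `&` dom a)) (coord a y).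
Proof. by move=> Uy ay; exists y. Qed.

Lemma smooth_in_charts_differentiable (W : normedModType R) U
    (F : M -> M -> W) a y :
  smooth_in_charts U F -> U y -> dom a y ->
  differentiable (F a \o param a) (coord a y).
Proof.
move=> sF Uy ay; apply: smooth_on_differentiable (sF a) _.
exact: chart_image_coord.
Qed.

End OneManifold.

(** Common generalization of [transition] ([f] the identity) and of [tangent_map] (the charts at [y]
    and [f y]), so that one chain rule serves for both. *)
Definition chart_jacobian n m (N : manifold R n) (M : manifold R m)
    (f : N -> M) (a : N) (b : M) (y : N) : 'M[R]_(n, m) :=
  'J (coord b \o f \o param a) (coord a y).

Section SmoothMaps.
Context (n m : nat) (N : manifold R n) (M : manifold R m) (f : N -> M).
Hypothesis smooth_f : smooth_map f.

Lemma open_chart_preimage a b :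
  open (coord a @` (f @^-1` dom b `&` dom a)).
Proof.
apply: open_chart_image; apply: open_comp; last exact: dom_open.
by move=> x _; exact: smooth_f.1.
Qed.

Lemma smooth_chart_map a b :
  smooth_on (coord a @` (f @^-1` dom b `&` dom a)) (coord b \o f \o param a).
Proof. by rewrite setIC; exact: smooth_f.2. Qed.

Lemma differentiable_chart_map a b y : dom a y -> dom b (f y) ->
  differentiable (coord b \o f \o param a) (coord a y).
Proof.
move=> ay bfy; apply: smooth_on_differentiable (@smooth_chart_map a b) _.
exact: chart_image_coord.
Qed.

Lemma smooth_chart_jacobian a b :
  smooth_on (coord a @` (f @^-1` dom b `&` dom a))
    (chart_jacobian f a b \o param a).
Proof.
have oD := @open_chart_preimage a b.
have sJ := smooth_on_jacobian oD (@smooth_chart_map a b).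
refine (smooth_on_ext oD _ sJ) => u; rewrite inE => /chart_imageP[_ _ uE].
by rewrite /chart_jacobian /= uE.
Qed.

Lemma chart_jacobian_comp p (Q : manifold R p) (g : M -> Q) a b c y :
  smooth_map g -> dom a y -> dom b (f y) -> dom c (g (f y)) ->
  chart_jacobian (g \o f) a c y =
  chart_jacobian f a b y *m chart_jacobian g b c (f y).
Proof.
move=> smooth_g ay bfy cgfy.
have df := differentiable_chart_map ay bfy.
have dg : differentiable (coord c \o g \o param b)
    ((coord b \o f \o param a) (coord a y)).
  rewrite /= coordK//; apply: smooth_on_differentiable (smooth_g.2 b c) _.
  by exists (f y).
(* The two maps differ by an inserted [param b \o coord b], the identity on [dom b]. *)
transitivity ('J ((coord c \o g \o param b) \o (coord b \o f \o param a))
    (coord a y)).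
  apply/esym/near_eq_jacobian; last exact: differentiable_comp.
  apply: open_near_eq (@open_chart_preimage a b) _ _.
    exact: chart_image_coord.
  by move=> u; rewrite inE => /chart_imageP[/= bu _ _]; rewrite /= coordK.
rewrite (jacobian_comp df dg) /chart_jacobian.
by congr (_ *m 'J _ _); rewrite /= coordK.
Qed.

End SmoothMaps.

(** * Transition matrices, coordinate fields and constant forms *)

Section Transition.
Context (n : nat) (M : manifold R n).
Implicit Types (a b c x y : M).

Lemma smooth_map_id : smooth_map (id : M -> M).
Proof. by split=> [x|a b]; [exact: cvg_id|exact: transition_smooth]. Qed.

Lemma transition_comp a b c y : dom a y -> dom b y -> dom c y ->
  transition a b y *m transition b c y = transition a c y.
Proof.
move=> ay by_ cy; apply: esym.
exact: (chart_jacobian_comp smooth_map_id smooth_map_id ay by_ cy).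
Qed.

Lemma transition_id a y : dom a y -> transition a a y = 1%:M.
Proof.
move=> ay; rewrite -(jacobian_id (coord a y)).
apply: near_eq_jacobian.
  apply: (open_near_eq (@coord_image_open _ _ M a)); first by exists y.
  by move=> u; rewrite inE => -[x ax <-]; rewrite /= coordK.
exact: (differentiable_chart_map smooth_map_id).
Qed.

Lemma transitionK a b y : dom a y -> dom b y ->
  transition a b y *m transition b a y = 1%:M.
Proof. by move=> ay by_; rewrite transition_comp// transition_id. Qed.

Lemma smooth_transition a b :
  smooth_on (coord a @` (dom b `&` dom a)) (transition a b \o param a).
Proof. exact: (smooth_chart_jacobian smooth_map_id). Qed.

(** In chart [b] the field is a row of [transition a b]. What [smooth_transition] makes smooth as a
    function on chart [b] is [transition b a], so its inverse is taken. *)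
Lemma smooth_frame a j : smooth_vfield (dom a) (frame a j).
Proof.
move=> b; have oD : open (coord b @` (dom a `&` dom b)).
  exact/open_chart_image/dom_open.
have uT u : (coord b @` (dom a `&` dom b)) u ->
    (transition b a \o param b) u \in unitmx.
  by move=> /chart_imageP[au bu _]; exact: (mulmx1_unit (transitionK bu au)).1.
have sV := smooth_on_invmx oD uT (@smooth_transition b a).
have sF := smooth_on_mulmx oD
  (@smooth_on_cst _ _ _ _ (delta_mx 0 j : 'rV[R]_n)) sV.
refine (smooth_on_ext oD _ sF) => u; rewrite inE => /chart_imageP[au bu _].
have tK := transitionK bu au; have [uTu _] := mulmx1_unit tK.
rewrite /= /vfield_in /frame rowE -mulmxA transition_comp//; last exact: dom_self.
by rewrite -[invmx _]mulmx1 -tK mulKmx.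
Qed.

(** This form has constant components [be] in chart [a]; it extends a covector at a point to a
    smooth local form. *)
Lemma smooth_cst_oneform a (be : 'cV[R]_n) :
  smooth_oneform (dom a) (fun y => transition y a y *m be).
Proof.
move=> b; have oD : open (coord b @` (dom a `&` dom b)).
  exact/open_chart_image/dom_open.
have sF := smooth_on_mulmx oD (@smooth_transition b a)
  (@smooth_on_cst _ _ _ _ be).
refine (smooth_on_ext oD _ sF) => u; rewrite inE => /chart_imageP[au bu _].
have yy : dom (param b u) (param b u) by exact: dom_self.
by rewrite /oneform_in /= [RHS]mulmxA (transition_comp bu yy au).
Qed.

End Transition.

End Charts.

(** * Connections in a chart *)

Lemma gram_change (R : realType) n (T T' H : 'M[R]_n) (a b : 'cV[R]_n) :
  T *m T' = 1%:M ->
  (T' *m a)^T *m (T^T *m H *m T) *m (T' *m b) = a^T *m H *m b.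
Proof.
move=> TT'; rewrite trmx_mul !mulmxA -(mulmxA _ T T') TT' mulmx1.
by rewrite -(mulmxA a^T T'^T) -trmx_mul TT' trmx1 mulmx1.
Qed.

Section ChristoffelForm.
Context (R : realType) (n : nat) (M : manifold R n) (nabla : covderiv M).
Implicit Types (x : M) (v : 'rV[R]_n).

(** With fields as rows, [Y *m christoffel x v] is the term of [nabla_v Y] that does not
    differentiate the components of [Y]. *)
Definition christoffel x v : 'M[R]_n := \matrix_j nabla x v (frame x j).

(* The matrix of the bilinear form (nabla_v h) on T*_x M. *)
Definition nabla_biv_mx (h : bivector M) x v : 'M[R]_n :=
  'D_v (bivector_in h x \o param x) (coord x x)
  + (christoffel x v)^T *m h x + h x *m christoffel x v.

Lemma bivector_in_self (h : bivector M) x : bivector_in h x x = h x.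
Proof.
by rewrite /bivector_in (transition_id (dom_self x)) trmx1 mul1mx mulmx1.
Qed.

Lemma oneform_in_self (be : oneform M) x : oneform_in be x x = be x.
Proof. by rewrite /oneform_in (transition_id (dom_self x)) mul1mx. Qed.

Lemma biv_eval_in (h : bivector M) (be ga : oneform M) x y : dom x y ->
  biv_eval (h y) (be y) (ga y) =
  biv_eval (bivector_in h x y) (oneform_in be x y) (oneform_in ga x y).
Proof.
move=> xy; have yx := transitionK (dom_self y) xy.
by rewrite /biv_eval /bivector_in /oneform_in gram_change.
Qed.

Lemma nabla_formE x v (be : oneform M) :
  derivable (oneform_in be x \o param x) (coord x x) v ->
  nabla_form nabla x v be =
  'D_v (oneform_in be x \o param x) (coord x x) - christoffel x v *m be x.
Proof.
move=> dbe; apply/colP => j; rewrite !mxE derive_entry//.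
congr (_ - _).
  rewrite /dfun; congr ('D_v _ _); apply/funext => u.
  by rewrite /= /oneform_in /frame -row_mul mxE.
by apply: eq_bigr => k _; rewrite mxE.
Qed.

(** The derivatives of [be] and [ga] given by the Leibniz rule cancel against those in [nabla_form],
    so only the values of the forms at [x] remain. *)
Lemma nabla_bivE (h : bivector M) U x v (be ga : oneform M) :
  U x -> smooth_bivector setT h -> smooth_oneform U be -> smooth_oneform U ga ->
  nabla_biv nabla h x v be ga =
  ((be x)^T *m nabla_biv_mx h x v *m ga x) 0 0.
Proof.
move=> Ux sh sbe sga; have xx := dom_self x.
have dH : derivable (bivector_in h x \o param x) (coord x x) v.
  by apply: diff_derivable; exact: (smooth_in_charts_differentiable sh).
have dB : derivable (oneform_in be x \o param x) (coord x x) v.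
  by apply: diff_derivable; exact: (smooth_in_charts_differentiable sbe).
have dG : derivable (oneform_in ga x \o param x) (coord x x) v.
  by apply: diff_derivable; exact: (smooth_in_charts_differentiable sga).
rewrite /nabla_biv !nabla_formE// /nabla_biv_mx.
pose H := bivector_in h x \o param x; pose B := oneform_in be x \o param x.
pose G := oneform_in ga x \o param x.
have H0 : H (coord x x) = h x by rewrite /H /= coordK// bivector_in_self.
have B0 : B (coord x x) = be x by rewrite /B /= coordK// oneform_in_self.
have G0 : G (coord x x) = ga x by rewrite /G /= coordK// oneform_in_self.
rewrite -/H -/B -/G in dH dB dG *.
have dBt := derivable_trmx dB; have dBH := derivable_mulmx dBt dH.
have dBHG := derivable_mulmx dBH dG.
have -> : dfun x v (fun y => biv_eval (h y) (be y) (ga y)) =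
    ('D_v (fun u => (B u)^T *m H u *m G u) (coord x x)) 0 0.
  rewrite (derive_entry _ _ dBHG); apply: near_eq_derive.
  apply: (open_near_eq (@coord_image_open _ _ M x)); first by exists x.
  move=> u; rewrite inE => -[y xy <-].
  by rewrite /B /H /G /= coordK// (biv_eval_in _ _ _ xy).
rewrite (derive_mulmx dBH dG) (derive_mulmx dBt dH) (derive_trmx dB) B0 H0 G0.
move: ('D_v B _) ('D_v H _) ('D_v G _) (christoffel _ _) => DB DH DG C.
rewrite /biv_eval !linearB/= trmx_mul.
rewrite !(mulmxDl, mulmxDr, mulmxBl, mulmxBr, mulNmx, mulmxN) !mulmxA.
(* Distributing entries over sums makes the entry of each matrix product an atom for [ring]. *)
have eD p q (X Y : 'M[R]_(p, q)) i j : (X + Y) i j = X i j + Y i j.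
  by rewrite mxE.
have eN p q (X : 'M[R]_(p, q)) i j : (- X) i j = - X i j by rewrite mxE.
rewrite !(eD, eN).
ring.
Qed.

End ChristoffelForm.

(** * The K-V condition as an identity between covectors at a point *)

Section KVPointwise.
Context (R : realType) (n : nat) (M : manifold R n) (nabla : covderiv M).

Lemma KV_pointwise (h : bivector M) x (a b c : 'cV[R]_n) :
  KV_manifold nabla h ->
  b^T *m nabla_biv_mx nabla h x (sharp (h x) a) *m c =
  a^T *m nabla_biv_mx nabla h x (sharp (h x) b) *m c.
Proof.
move=> [_ [_ sh] KV]; pose form (al : 'cV[R]_n) : oneform M :=
  fun y => transition y x y *m al.
have sform al : smooth_oneform (dom x) (form al) by exact: smooth_cst_oneform.
have form_x al : form al x = al.
  by rewrite /form (transition_id (dom_self x)) mul1mx.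
have := KV (dom x) x (form a) (form b) (form c) (dom_open x) (dom_self x)
  (sform a) (sform b) (sform c).
rewrite !(nabla_bivE _ _ (dom_self x) sh (sform _) (sform _)) !form_x => e.
by apply/matrixP => i j; rewrite !ord1.
Qed.

End KVPointwise.

(** * Submanifolds *)

Section TangentMap.
Context (R : realType) (n m : nat) (N : manifold R n) (M : manifold R m).
Context (iota : N -> M).
Hypothesis smooth_iota : smooth_map iota.

Lemma chart_preimage_coord a b y : dom a y -> dom b (iota y) ->
  (coord a @` (iota @^-1` dom b `&` dom a)) (coord a y).
Proof. by move=> ay biy; exists y. Qed.

Lemma chart_jacobian_tangent a b y : dom a y -> dom b (iota y) ->
  chart_jacobian iota a b y =
  transition a y y *m tangent_map iota y *m transition (iota y) b (iota y).
Proof.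
move=> ay biy; have yy := dom_self y; have iyy := dom_self (iota y).
have e1 := chart_jacobian_comp (@smooth_map_id _ _ N) smooth_iota ay yy biy.
have e2 := chart_jacobian_comp smooth_iota (@smooth_map_id _ _ M) yy iyy biy.
by rewrite -mulmxA; apply: (eq_trans e1); congr (_ *m _); exact: e2.
Qed.

Lemma cov_alongE (nabla : covderiv M) (E : normedModType R) (f : E -> M)
    (V : E -> 'rV[R]_m) (e w : E) :
  cov_along nabla f V e w =
  'D_w (fun e' => V e' *m transition (f e') (f e) (f e')) e
  + V e *m christoffel nabla (f e) ('D_w (coord (f e) \o f) e).
Proof.
rewrite /cov_along mulmx_sum_row; congr (_ + _).
by apply: eq_bigr => j _; rewrite rowK.
Qed.

Lemma derive_chart_map x v :
  'D_v (coord (iota x) \o iota \o param x) (coord x x) = v *m tangent_map iota x.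
Proof.
apply: deriveEjacobian.
exact: (differentiable_chart_map smooth_iota (dom_self x) (dom_self (iota x))).
Qed.

Lemma derivable_tangent_map x v :
  derivable (chart_jacobian iota x (iota x) \o param x) (coord x x) v.
Proof.
apply: diff_derivable; apply: smooth_on_differentiable.
  exact: (smooth_chart_jacobian smooth_iota (a := x) (b := iota x)).
exact: (chart_preimage_coord (dom_self x) (dom_self (iota x))).
Qed.

(* Gauss formula: the induced connection and nabla differ by the derivative of
   the tangent map. *)
Lemma induced_christoffel (nabla : covderiv M) (nablaN : covderiv N) x v :
  induced_connection nabla iota nablaN ->
  'D_v (chart_jacobian iota x (iota x) \o param x) (coord x x)
  + tangent_map iota x *m christoffel nabla (iota x) (v *m tangent_map iota x)
  = christoffel nablaN x v *m tangent_map iota x.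
Proof.
move=> ind; apply/row_matrixP => j.
have xx := dom_self x; have ixx := dom_self (iota x).
(* Row [j] is the defining property of the induced connection, tested on the [j]-th coordinate field
   of the chart at [x]. *)
have := ind (dom x) x v (frame x j) (dom_open x) xx (@smooth_frame _ _ N x j).
have fe : (iota \o param x) (coord x x) = iota x by rewrite /= coordK.
rewrite cov_alongE fe row_mul rowK => <-.
have -> : 'D_v (coord (iota x) \o (iota \o param x)) (coord x x) =
  v *m tangent_map iota x by exact: derive_chart_map.
rewrite linearD /=; congr (_ + _).
  have dJ := @derivable_tangent_map x v.
  (* Read in the fixed chart at [iota x], the image of this coordinate field is row [j] of the chart
     Jacobian. *)
  transitivity ('D_v (fun u => (delta_mx 0 j : 'rV[R]_n) *m
      (chart_jacobian iota x (iota x) \o param x) u) (coord x x)).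
    rewrite (derive_mulmx (@derivable_cst _ _ _ _ (coord x x) v) dJ).
    by rewrite derive_cst mul0mx add0r rowE.
  apply: near_eq_derive.
  apply: (open_near_eq (@open_chart_preimage _ _ _ _ _ _ smooth_iota x (iota x))).
    exact: (chart_preimage_coord xx ixx).
  move=> u; rewrite inE => /chart_imageP[ixu xu _].
  by rewrite [in LHS]/= (chart_jacobian_tangent xu ixu) /frame rowE !mulmxA.
rewrite row_mul coordK// /frame (transition_id xx); congr (_ *m _).
by rewrite !rowE mulmx1.
Qed.

End TangentMap.

(** * Smoothness of the projection and of the induced bivector *)

Section InducedBivector.
Context (R : realType) (n m : nat) (N : manifold R n) (M : manifold R m).
Context (iota : N -> M) (h : bivector M) (p : N -> 'M[R]_(m, n)).
Hypothesis smooth_iota : smooth_map iota.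
Hypothesis smooth_h : smooth_bivector setT h.
Hypothesis free_iota : forall y, row_free (tangent_map iota y).
Hypothesis transversal_iota :
  forall y, transversal_mx (tangent_map iota y) (h (iota y)).
Hypothesis projection_p :
  forall y, is_projection (tangent_map iota y) (h (iota y)) (p y).

Definition projection_in (a : N) (b : M) (y : N) : 'M[R]_(m, n) :=
  transition b (iota y) (iota y) *m p y *m transition y a y.

Lemma projection_inP a b y : dom a y -> dom b (iota y) ->
  [/\ row_free (chart_jacobian iota a b y),
      transversal_mx (chart_jacobian iota a b y) (bivector_in h b (iota y))
    & is_projection (chart_jacobian iota a b y) (bivector_in h b (iota y))
        (projection_in a b y)].
Proof.
move=> ay biy; rewrite (chart_jacobian_tangent smooth_iota ay biy).
have TN := transitionK ay (dom_self y).
have TM := transitionK (dom_self (iota y)) biy.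
split; first exact: row_free_change TN TM _ (free_iota y).
  exact: transversal_mx_change TN TM _ _ (transversal_iota y).
exact: is_projection_change TN TM _ _ _ (projection_p y).
Qed.

Lemma smooth_bivector_along a b :
  smooth_on (coord a @` (iota @^-1` dom b `&` dom a))
    (fun u => bivector_in h b (iota (param a u))).
Proof.
have oD := @open_chart_preimage _ _ _ _ _ _ smooth_iota a b.
have oE : open (coord b @` (setT `&` dom b)) by exact/open_chart_image/openT.
have DE : coord a @` (iota @^-1` dom b `&` dom a) `<=`
    (coord b \o iota \o param a) @^-1` (coord b @` (setT `&` dom b)).
  by move=> _ [y [biy ay] <-]; rewrite /= coordK//; exists (iota y).
have sc := smooth_on_comp oD oE DE
  (@smooth_chart_map _ _ _ _ _ _ smooth_iota a b) (@smooth_h b).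
refine (smooth_on_ext oD _ sc) => u; rewrite inE => /chart_imageP[biu _ _].
by rewrite /= coordK.
Qed.

(** [p] is only characterized point by point. Uniqueness identifies it, in charts, with the explicit
    [projection], a product of smooth matrices and inverses of smooth matrices. *)
Lemma smooth_projection_in a b :
  smooth_on (coord a @` (iota @^-1` dom b `&` dom a))
    (projection_in a b \o param a).
Proof.
have oD := @open_chart_preimage _ _ _ _ _ _ smooth_iota a b.
set D := coord a @` _ in oD *.
pose J := chart_jacobian iota a b \o param a.
pose H u := bivector_in h b (iota (param a u)).
have JP u : D u -> [/\ row_free (J u), transversal_mx (J u) (H u)
    & is_projection (J u) (H u) (projection_in a b (param a u))].
  by move=> /chart_imageP[biu au _]; exact: projection_inP.
have sJ : smooth_on D J by exact: smooth_chart_jacobian.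
have sH : smooth_on D H by exact: smooth_bivector_along.
have sJt : smooth_on D (fun u => (J u)^T) by exact: smooth_on_trmx.
have uG u : D u -> J u *m (J u)^T \in unitmx.
  by move=> /JP[fJ _ _]; exact: gram_unitmx.
have sG := smooth_on_invmx oD uG (smooth_on_mulmx oD sJ sJt).
have sQ : smooth_on D (fun u => annihilator_proj (J u)).
  have sJGJ := smooth_on_mulmx oD (smooth_on_mulmx oD sJt sG) sJ.
  have sN := smooth_on_mulmx oD (@smooth_on_cst _ _ _ D (- 1%:M : 'M[R]_m)) sJGJ.
  have sQ := smooth_onD oD (@smooth_on_cst _ _ _ D (1%:M : 'M[R]_m)) sN.
  refine (smooth_on_ext oD _ sQ) => u _.
  by rewrite mulNmx mul1mx.
have sS : smooth_on D (fun u => splitting (J u) (H u)).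
  exact: (smooth_onD oD (smooth_on_mulmx oD sJt sJ) (smooth_on_mulmx oD sQ sH)).
have uS u : D u -> splitting (J u) (H u) \in unitmx.
  by move=> /JP[fJ tJ _]; exact: splitting_unitmx.
have sP := smooth_on_mulmx oD (smooth_on_invmx oD uS sS) sJt.
refine (smooth_on_ext oD _ sP) => u; rewrite inE => /JP[fJ tJ pJ].
exact: (is_projection_unique tJ (projectionP fJ tJ) pJ).
Qed.

Variable hN : bivector N.
Hypothesis hNE : forall y, hN y = (p y)^T *m h (iota y) *m p y.

Lemma induced_bivector_in a b y : dom a y -> dom b (iota y) ->
  bivector_in hN a y =
  (projection_in a b y)^T *m bivector_in h b (iota y) *m projection_in a b y.
Proof.
move=> ay biy; have TM := transitionK (dom_self (iota y)) biy.
rewrite /bivector_in /projection_in hNE.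
move: (transition y a y) (transition (iota y) b _) (transition b _ _) TM.
move=> A C C' CC'; rewrite !trmx_mul !mulmxA.
rewrite -(mulmxA _ C C') CC' mulmx1 -(mulmxA _ C'^T C^T) -(trmx_mul C C') CC' trmx1.
by rewrite mulmx1.
Qed.

Lemma smooth_induced_bivector : smooth_bivector setT hN.
Proof.
(* One chart of [M] may not contain the image of all of [dom a]; around each [y] the chart at
   [iota y] is used. *)
move=> a; apply: smooth_on_local => _ [y [_ ay] <-]; pose b := iota y.
exists (coord a @` (iota @^-1` dom b `&` dom a)); last first.
  exact: (chart_preimage_coord ay (dom_self (iota y))).
have oD := @open_chart_preimage _ _ _ _ _ _ smooth_iota a b.
have sP := @smooth_projection_in a b.
have sH := @smooth_bivector_along a b.
have sK := smooth_on_mulmx oD (smooth_on_mulmx oD (smooth_on_trmx oD sP) sH) sP.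
refine (smooth_on_ext oD _ sK) => u; rewrite inE => /chart_imageP[bu au _].
by rewrite [RHS]/= (induced_bivector_in au bu).
Qed.

End InducedBivector.

(** The hypotheses on [DJ] are the derivative of [J P = 1] and the Gauss formula; they give
    [CN = J C P - J DP]. With [K = P^T H P] and [K J = P^T H], this yields
    [K CN = P^T H C P - P^T H DP]. This and its transpose cancel the terms in [DP]. *)
Lemma restrict_nabla_biv (R : realType) n m (J DJ : 'M[R]_(n, m))
    (P DP : 'M[R]_(m, n)) (H DH C : 'M[R]_m) (CN : 'M[R]_n) :
  H^T = H -> is_projection J H P -> DJ *m P + J *m DP = 0 ->
  DJ + J *m C = CN *m J ->
  DP^T *m H *m P + P^T *m DH *m P + P^T *m H *m DP
  + CN^T *m (P^T *m H *m P) + P^T *m H *m P *m CN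
  = P^T *m (DH + C^T *m H + H *m C) *m P.
Proof.
move=> sH pP DJP CNJ; have HKJ := projection_sharp sH pP; have [JP _] := pP.
have CNE : CN = J *m C *m P - J *m DP.
  rewrite -[CN]mulmx1 -JP mulmxA -CNJ mulmxDl addrC.
  by rewrite -[DJ *m P](addrK (J *m DP)) DJP sub0r.
have KCN : P^T *m H *m P *m CN = P^T *m H *m C *m P - P^T *m H *m DP.
  by rewrite CNE mulmxBr !mulmxA -HKJ.
have CNK : CN^T *m (P^T *m H *m P) = P^T *m C^T *m H *m P - DP^T *m H *m P.
  apply: trmx_inj; rewrite trmx_mul trmxK.
  have -> : (P^T *m H *m P)^T = P^T *m H *m P.
    by rewrite !trmx_mul trmxK sH mulmxA.
  by rewrite KCN linearB /= !trmx_mul !trmxK sH !mulmxA.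
rewrite CNK KCN mulmxDr mulmxDr !mulmxDl !mulmxA.
set x := DP^T *m H *m P; set z := P^T *m H *m DP.
(* Each [DP] term is paired with its opposite; the three others form the right-hand side. *)
rewrite !addrA [LHS](ACl (2*4*6*(1*5)*(3*7)))%AC /=.
by rewrite !subrr !addr0.
Qed.

(** * Restriction of the derivative of the bivector to the transversal *)

Section TransversalKV.
Context (R : realType) (n m : nat) (M : manifold R m) (N : manifold R n).
Context (nabla : covderiv M) (nablaN : covderiv N) (iota : N -> M).
Context (h : bivector M) (p : N -> 'M[R]_(m, n)) (hN : bivector N).
Hypothesis sym_h : symmetric_bivector_field h.
Hypothesis smooth_iota : smooth_map iota.
Hypothesis free_iota : forall y, row_free (tangent_map iota y).
Hypothesis transversal_iota :
  forall y, transversal_mx (tangent_map iota y) (h (iota y)).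
Hypothesis projection_p :
  forall y, is_projection (tangent_map iota y) (h (iota y)) (p y).
Hypothesis hNE : forall y, hN y = (p y)^T *m h (iota y) *m p y.
Hypothesis induced : induced_connection nabla iota nablaN.

Lemma nabla_induced_bivector x v :
  nabla_biv_mx nablaN hN x v =
  (p x)^T *m nabla_biv_mx nabla h (iota x) (v *m tangent_map iota x) *m p x.
Proof.
have xx := dom_self x; have ixx := dom_self (iota x).
have oD := @open_chart_preimage _ _ _ _ _ _ smooth_iota x (iota x).
have Du0 := @chart_preimage_coord _ _ _ _ _ iota x (iota x) x xx ixx.
set D := coord x @` _ in oD Du0; set u0 := coord x x in Du0.
have pu0 : param x u0 = x by exact: coordK.
(* The charts at [x] and [iota x] stay fixed while the point moves, so these matrices can be
   differentiated; at [u0] they are the tangent map, [p x] and [h (iota x)]. *)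
pose J := chart_jacobian iota x (iota x) \o param x.
pose P := projection_in iota p x (iota x) \o param x.
pose H := fun u => bivector_in h (iota x) (iota (param x u)).
have J0 : J u0 = tangent_map iota x by rewrite /J /= pu0.
have P0 : P u0 = p x.
  rewrite /P /= pu0 /projection_in (transition_id xx) (transition_id ixx).
  by rewrite mul1mx mulmx1.
have H0 : H u0 = h (iota x) by rewrite /H pu0 bivector_in_self.
have dJ : derivable J u0 v by exact: derivable_tangent_map.
have dP : derivable P u0 v.
  apply: diff_derivable; apply: smooth_on_differentiable Du0.
  exact: (smooth_projection_in smooth_iota sym_h.2).
have dH : derivable H u0 v.
  apply: diff_derivable; apply: smooth_on_differentiable Du0.
  exact: (smooth_bivector_along smooth_iota sym_h.2).
(* Chain rule: differentiating [h] along N in the direction [v] is differentiating it on M in the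
   direction [v J]. *)
have DHE : 'D_v H u0 = 'D_(v *m tangent_map iota x)
    (bivector_in h (iota x) \o param (iota x)) (coord (iota x) (iota x)).
  transitivity ('D_v ((bivector_in h (iota x) \o param (iota x)) \o
      (coord (iota x) \o iota \o param x)) u0).
    apply: near_eq_derive; apply: (open_near_eq oD Du0) => u.
    by rewrite inE => /chart_imageP[ixu _ _]; rewrite /H /= coordK.
  have phi0 : (coord (iota x) \o iota \o param x) u0 = coord (iota x) (iota x).
    by rewrite /= pu0.
  have dphi := differentiable_chart_map smooth_iota xx ixx.
  have dh := smooth_in_charts_differentiable sym_h.2 (I : setT (iota x)) ixx.
  rewrite -phi0 in dh; rewrite (derive_comp _ dphi dh) phi0.
  by rewrite (derive_chart_map smooth_iota).
have DJP : 'D_v J u0 *m P u0 + J u0 *m 'D_v P u0 = 0.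
  rewrite -(derive_mulmx dJ dP) -(derive_cst (1%:M : 'M[R]_n) u0 v).
  apply: near_eq_derive; apply: (open_near_eq oD Du0) => u.
  rewrite inE => /chart_imageP[ixu xu _].
  by have [_ _ []] := projection_inP smooth_iota free_iota transversal_iota
    projection_p xu ixu.
have dPt := derivable_trmx dP; have dPtH := derivable_mulmx dPt dH.
have DK : 'D_v (bivector_in hN x \o param x) u0 =
    ('D_v P u0)^T *m H u0 *m P u0 + (P u0)^T *m 'D_v H u0 *m P u0
    + (P u0)^T *m H u0 *m 'D_v P u0.
  rewrite -mulmxDl -(derive_trmx dP) -(derive_mulmx dPt dH).
  rewrite -(derive_mulmx dPtH dP).
  apply: near_eq_derive; apply: (open_near_eq oD Du0) => u.
  rewrite inE => /chart_imageP[ixu xu _].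
  exact: (induced_bivector_in hNE xu ixu).
rewrite /nabla_biv_mx -/u0 DK hNE P0 H0 DHE.
have := induced_christoffel smooth_iota x v (@induced); rewrite -/J -/u0 => CNE.
apply: restrict_nabla_biv CNE; first exact: sym_h.1.
  exact: projection_p.
by rewrite -P0 -J0.
Qed.

End TransversalKV.

Theorem proposition6p2 (R : realType) (m n : nat)
    (M : manifold R m) (nabla : covderiv M) (h : bivector M)
    (N : manifold R n) (iota : N -> M) (nablaN : covderiv N) :
  KV_manifold nabla h ->
  KV_transversal nabla h iota nablaN ->
  (exists! p : N -> 'M[R]_(m, n), transversal_projection h iota p) /\
  (forall p : N -> 'M[R]_(m, n), transversal_projection h iota p ->
     (exists! hN : bivector N, induced_bivector h iota p hN) /\
     (forall hN : bivector N, induced_bivector h iota p hN ->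
        KV_manifold nablaN hN)).
Proof.
move=> KVh [[[smooth_iota _ free_iota] affN ind _] tr].
have [_ sym_h _] := KVh.
have trJ y : transversal_mx (tangent_map iota y) (h (iota y)) by exact: tr.
split.
  exists (fun y => projection (tangent_map iota y) (h (iota y))); split.
    by move=> y; exact: projectionP.
  move=> p proj_p; apply/funext => y.
  exact: (is_projection_unique (trJ y) (projectionP (free_iota y) (trJ y))
    (proj_p y)).
move=> p proj_p.
(* Testing the formula for the sharp map on basis covectors determines the whole matrix; this also
   gives uniqueness. *)
have hNE hN : (forall y (al : 'cV[R]_n),
      sharp (hN y) al = sharp (h (iota y)) (p y *m al) *m p y) ->
    forall y, hN y = (p y)^T *m h (iota y) *m p y.
  move=> shN y; apply/row_matrixP => i; have := shN y (delta_mx i 0).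
  by rewrite /sharp trmx_mul trmx_delta -!mulmxA -!rowE.
split.
  exists (fun y => (p y)^T *m h (iota y) *m p y); split.
    split; last by move=> y al; rewrite /sharp trmx_mul !mulmxA.
    split; first by move=> y; rewrite !trmx_mul trmxK sym_h.1 mulmxA.
    exact: (smooth_induced_bivector smooth_iota sym_h.2 free_iota trJ proj_p).
  by move=> hN [_ /hNE hNp]; apply/funext => y; rewrite hNp.
(* The affine structure is [affN] and the symmetry and smoothness are [sym_hN]; the K-V identity
   remains. *)
move=> hN [sym_hN shN]; have hNp := hNE _ shN; split=> //.
move=> U x al be ga oU Ux sal sbe sga.
rewrite (nabla_bivE _ _ Ux sym_hN.2 sbe sga) (nabla_bivE _ _ Ux sym_hN.2 sal sga).
(* The inclusion sends the sharp of [a] for [hN] to the sharp of [p^* a] for [h], because the latter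
   is already tangent to N. *)
have sharpE a : sharp (hN x) a *m tangent_map iota x =
    sharp (h (iota x)) (p x *m a).
  rewrite /sharp hNp trmx_mul -!mulmxA.
  have := projection_sharp (sym_h.1 (iota x)) (proj_p x).
  by rewrite -!mulmxA => <-.
rewrite !(nabla_induced_bivector sym_h smooth_iota free_iota trJ proj_p hNp ind).
have := KV_pointwise (iota x) (p x *m al x) (p x *m be x) (p x *m ga x) KVh.
by rewrite !sharpE !trmx_mul !mulmxA => ->.
Qed.
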